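(* Let $\Sigma=(X,\mathcal{U},\phi)$ be a control system, let $R\in\mathbb{R}_+\cup\{\infty\}$, and let $\mathcal{D}:=\{u\in\mathcal{U}:\|u\|_{\mathcal{U}}\le R\}$. Suppose that $\mathcal{D}$ satisfies the axiom of concatenation, that $\Sigma$ satisfies the boundedness-implies-continuation (BIC) property, and that the flow of $\Sigma$ is Lipschitz continuous on compact intervals uniformly in inputs from $\mathcal{D}$. Then the following statements are equivalent: (i) $\Sigma$ is robustly forward complete. (ii) There exists a continuous, increasing function $\mu:\mathbb{R}_+^2\to\mathbb{R}_+$ such that for all $x\in X$, $u\in\mathcal{D}$ and all $t\ge 0$ we have $\|\phi(t,x,u)\|_X\le\mu(\|x\|_X,t)$. (iii) There exists a continuous function $\mu:\mathbb{R}_+^2\to\mathbb{R}_+$ such that for all $x\in X$, $u\in\mathcal{D}$ and all $t\ge 0$ we have $\|\phi(t,x,u)\|_X\le\mu(\|x\|_X,t)$. (iv) There are $\xi\in\mathcal{K}_\infty$ and $c>0$ such that for all $t\ge 0$, $x\in X$, $u\in\mathcal{D}$ we have $\|\phi(t,x,u)\|_X\le\xi(\|x\|_X)+\xi(t)+c$. (v) There are a Lipschitz continuous function $V:X\to\mathbb{R}_+$, maps $\psi_1,\psi_2\in\mathcal{K}_\infty$, and $C>0$ such that $$\psi_1(\|x\|_X)\le V(x)\le\psi_2(\|x\|_X)+C,\quad x\in X,$$ and there are $a,M>0$ such that for all $x\in X$ and $u\in\mathcal{D}$ $$\dot V_u(x)\le aV(x)+M.$$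
   Context: $\mathbb{R}_+=[0,\infty)$. $\mathcal{K}$ is the set of continuous strictly increasing $\gamma:\mathbb{R}_+\to\mathbb{R}_+$ with $\gamma(0)=0$; $\mathcal{K}_\infty$ is the set of unbounded $\gamma\in\mathcal{K}$. $B_r=\{x\in X:\|x\|_X<r\}$. A function $\mu:\mathbb{R}_+^2\to\mathbb{R}_+$ is increasing if $(r_1,r_2)\le(R_1,R_2)$ componentwise implies $\mu(r_1,r_2)\le\mu(R_1,R_2)$. Control system: a triple $\Sigma=(X,\mathcal{U},\phi)$ consisting of: - a normed vector space $(X,\|\cdot\|_X)$ (state space); - a normed vector space of inputs $\mathcal{U}\subset\{u:\mathbb{R}_+\to U\}$ with norm $\|\cdot\|_{\mathcal{U}}$, where $U$ is a normed vector space (input values), satisfying the axiom of shift invariance: for all $u\in\mathcal{U}$, $\tau\ge0$, $u(\cdot+\tau)\in\mathcal{U}$ and $\|u\|_{\mathcal{U}}\ge\|u(\cdot+\tau)\|_{\mathcal{U}}$; - a map $\phi:D_\phi\to X$, $D_\phi\subseteq\mathbb{R}_+\times X\times\mathcal{U}$ (transition map, or flow), such that for all $(x,u)\in X\times\mathcal{U}$ one has $D_\phi\cap(\mathbb{R}_+\times\{(x,u)\})=[0,t_m)\times\{(x,u)\}$ for some $t_m=t_m(x,u)\in(0,+\infty]$; $[0,t_m)$ is called the maximal domain of definition of $t\mapsto\phi(t,x,u)$; with the following properties: - (identity) $\phi(0,x,u)=x$ for all $(x,u)\in X\times\mathcal{U}$; - (causality) for every $(t,x,u)\in D_\phi$ and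 every $\tilde u\in\mathcal{U}$ with $u(s)=\tilde u(s)$ for all $s\in[0,t]$, one has $[0,t]\times\{(x,\tilde u)\}\subset D_\phi$ and $\phi(t,x,u)=\phi(t,x,\tilde u)$; - (continuity) for each $(x,u)\in X\times\mathcal{U}$, $t\mapsto\phi(t,x,u)$ is continuous on its maximal domain of definition; - (cocycle) for all $x\in X$, $u\in\mathcal{U}$, $t,h\ge0$ with $[0,t+h]\times\{(x,u)\}\subset D_\phi$, $\phi(h,\phi(t,x,u),u(t+\cdot))=\phi(t+h,x,u)$. BIC property: for each $(x,u)\in X\times\mathcal{U}$ with $t_m(x,u)<\infty$ and all $M>0$ there is $t\in[0,t_m(x,u))$ with $\|\phi(t,x,u)\|_X>M$. Forward completeness (for inputs in $\mathcal{D}$): $\mathbb{R}_+\times X\times\mathcal{D}\subset D_\phi$. Robust forward completeness (RFC): $\Sigma$ is forward complete for inputs in $\mathcal{D}$ and for any $r>0$ and any $\tau>0$, $\sup\{\|\phi(t,x,u)\|_X:\|x\|_X\le r,\ u\in\mathcal{D},\ t\in[0,\tau]\}<\infty$. Axiom of concatenation for $\mathcal{D}$: for all $u_1,u_2\in\mathcal{D}$ and all $t>0$, the function equal to $u_1(\tau)$ for $\tau\in[0,t]$ and to $u_2(\tau-t)$ for $\tau>t$ belongs to $\mathcal{D}$. The flow of $\Sigma$ is Lipschitz continuous on compact intervals uniformly in inputs from $\mathcal{D}$ if for any $\tau>0$ and any $r>0$ there is $L=L(\tau,r)>0$ such that for all $x,y\in B_r$, $t\in[0,\tau]$, $u\in\mathcal{D}$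 it holds that $\|\phi(t,x,u)-\phi(t,y,u)\|_X\le L\|x-y\|_X$. $\dot V_u(x)$ is the right upper Dini derivative of $t\mapsto V(\phi(t,x,u))$ at $t=0$: $\dot V_u(x):=\limsup_{t\to+0}\frac1t\big(V(\phi(t,x,u))-V(x)\big)$.
   Formalization: In (v), ''Lipschitz continuous'' for V is taken as Lipschitz on every ball B_r, with a constant depending on r; with one global Lipschitz constant the implication (i) ⇒ (v) is false, e.g. for x' = f(x), f ≥ 0 vanishing exactly at the integers and very large in between. *)

(* Defs.v *)
From HB Require Import structures.
From mathcomp Require Import all_boot all_order all_algebra.
From mathcomp Require Import all_classical all_reals all_analysis.

Set Implicit Arguments.
Unset Strict Implicit.
Unset Printing Implicit Defensive.

Import Order.TTheory GRing.Theory Num.Theory.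
Import numFieldNormedType.Exports.

Local Open Scope classical_set_scope.
Local Open Scope ring_scope.

(* Inputs are functions of time in [0, +oo[, i.e. on the type {nonneg R}. *)
Definition shift_input (R : realType) (U : Type) (tau : {nonneg R})
    (u : {nonneg R} -> U) : {nonneg R} -> U :=
  fun s => u (s%:num + tau%:num)%:nng.

(* In the second branch s > t, so `|s - t| is s - t; the norm only serves to
   make the argument visibly nonnegative. *)
Definition concat_input (R : realType) (U : Type) (t : {nonneg R})
    (u1 u2 : {nonneg R} -> U) : {nonneg R} -> U :=
  fun s => if s%:num <= t%:num then u1 s else u2 (`|s%:num - t%:num|)%:nng.

(* The input space, a normed space of functions {nonneg R} -> U carrying its
   own norm, is a normed module I together with a linear injection
   [inputval] of I into the space of all such functions.
   The flow is a partial map: [flow t x u] is meaningful only when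
   [flowdom (t, x, u)], and an equation between values of the flow is
   understood to include that both sides are defined. *)
Record controlSystem (R : realType) (X U I : normedModType R) := ControlSystem {
  inputval : {linear I -> ({nonneg R} -> U)} ;
  inputval_inj : injective inputval ;
  shift_invariance : forall (u : I) (tau : {nonneg R}),
    exists2 v : I, inputval v = shift_input tau (inputval u) & `|v| <= `|u| ;
  flowdom : set (R * X * I) ;
  flow : R -> X -> I -> X ;
  tmax : X -> I -> \bar R ;
  tmax_gt0 : forall x u, (0 < tmax x u)%E ;
  flowdomE : forall t x u,
    flowdom (t, x, u) <-> 0 <= t /\ (t%:E < tmax x u)%E ;
  flow_identity : forall x u, flow 0 x u = x ;
  flow_causality : forall t x u v, flowdom (t, x, u) ->
    (forall s : {nonneg R}, s%:num <= t -> inputval u s = inputval v s) ->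
    (forall s, 0 <= s <= t -> flowdom (s, x, v)) /\ flow t x u = flow t x v ;
  flow_continuity : forall x u,
    {within [set t | flowdom (t, x, u)], continuous (fun t => flow t x u)} ;
  flow_cocycle : forall (x : X) (u v : I) (t h : {nonneg R}),
    inputval v = shift_input t (inputval u) ->
    (forall s, 0 <= s <= t%:num + h%:num -> flowdom (s, x, u)) ->
    flowdom (h%:num, flow t%:num x u, v) /\
    flow h%:num (flow t%:num x u) v = flow (t%:num + h%:num) x u }.

Definition input_ball (R : realType) (I : normedModType R) (rho : \bar R) :
  set I := [set u | (`|u|%:E <= rho)%E].

Definition increasing2 (R : realType) (mu : R * R -> R) :=
  forall r1 r2 R1 R2, 0 <= r1 -> 0 <= r2 -> r1 <= R1 -> r2 <= R2 ->
    mu (r1, r2) <= mu (R1, R2).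

Definition quadrant (R : realType) : set (R * R) :=
  [set p | 0 <= p.1 /\ 0 <= p.2].

(* Functions R_+ -> R_+ and R_+^2 -> R_+ are given by functions on R and R * R
   of which only the values at nonnegative arguments matter. *)
Definition continuous_nonneg2 (R : realType) (mu : R * R -> R) :=
  {within @quadrant R, continuous mu} /\ (forall p, quadrant p -> 0 <= mu p).

Definition classK (R : realType) (gamma : R -> R) :=
  [/\ {within [set r | 0 <= r], continuous gamma},
      forall r s, 0 <= r -> r < s -> gamma r < gamma s &
      gamma 0 = 0].

Definition classKinf (R : realType) (gamma : R -> R) :=
  classK gamma /\ (forall M, exists2 r, 0 <= r & M < gamma r).

(* The Lipschitz constant may depend on the ball. With a constant uniform over
   X the Lyapunov characterization of robust forward completeness would fail,
   e.g. for scalar equations x' = f(x) with f >= 0 vanishing exactly at the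
   integers and very large in between. *)
Definition lipschitz_on_balls (R : realType) (X : normedModType R)
    (V : X -> R) :=
  forall r : R, 0 < r -> [lipschitz V x | x in [set x | `|x| < r]].

Section Properties.
Context (R : realType) (X U I : normedModType R) (S : controlSystem X U I).
Implicit Type D : set I.

Definition concatenation_axiom D :=
  forall u1 u2 (t : {nonneg R}), D u1 -> D u2 -> 0 < t%:num ->
  exists2 v, D v &
    inputval S v = concat_input t (inputval S u1) (inputval S u2).

Definition BIC := forall x u, (tmax S x u < +oo)%E ->
  forall M : R, 0 < M ->
  exists t, [/\ 0 <= t, (t%:E < tmax S x u)%E & M < `|flow S t x u|].

Definition forward_complete D :=
  forall t x u, 0 <= t -> D u -> flowdom S (t, x, u).

Definition robustly_forward_complete D :=
  forward_complete D /\
  forall r tau : R, 0 < r -> 0 < tau ->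
  (ereal_sup [set y : \bar R | exists t x u,
     [/\ (0 <= t <= tau)%R, (`|x| <= r)%R, D u & y = `|flow S t x u|%:E] ]
   < +oo)%E.

(* Forward completeness is not presupposed: the estimate is required at those
   times at which both trajectories exist. *)
Definition flow_lipschitz D :=
  forall tau r : R, 0 < tau -> 0 < r -> exists2 L : R, 0 < L &
  forall x y t u, `|x| < r -> `|y| < r -> 0 <= t <= tau -> D u ->
    flowdom S (t, x, u) -> flowdom S (t, y, u) ->
    `|flow S t x u - flow S t y u| <= L * `|x - y|.

(* The bound includes that the trajectories exist at all times. *)
Definition flow_bounded_by D (b : R -> R -> R) :=
  forall x u t, D u -> 0 <= t ->
    flowdom S (t, x, u) /\ `|flow S t x u| <= b `|x| t.

(* Since tmax x u > 0, the flow is defined near 0 on the right, so the limsup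
   does not see the values of [flow] outside [flowdom]. *)
Definition dini (V : X -> R) (x : X) (u : I) : \bar R :=
  limf_esup (fun t : R => (t^-1 * (V (flow S t x u) - V x))%:E) (0 : R)^'+.

End Properties.

(* Main.v *)
Require Import Defs.
From mathcomp Require Import all_boot all_order all_algebra.
From mathcomp Require Import all_classical all_reals all_analysis.
From mathcomp Require Import ring lra.
Import Order.TTheory GRing.Theory Num.Theory.
Import numFieldNormedType.Exports.
Local Open Scope classical_set_scope.
Local Open Scope ring_scope.

(* Robust forward completeness bounds the flow by [b n] as long as both the time
   and the norm of the initial state are at most [n + 1]; a piecewise linear
   majorant [xi] of [b] yields (iv), and [mu (r, t) = xi r + xi t + c] yields
   (ii). Conversely (iii) bounds the flow on compact sets by compactness.

   For (iv) => (v), let [eta] be a Lipschitz function of class K_oo growing so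
   slowly that [eta |phi(t, x, u)| <= |x| + t + 1], and put
     [V x = sup_(t, u) max 1 (exp (- t) * eta |phi(t, x, u)|)].
   For [|x| < r] only times up to some [T(r)] contribute more than [1], so that
   [V] is Lipschitz on balls, and concatenating inputs gives
   [V (phi(h, x, u)) <= exp h * V x].

   For (v) => (i), a comparison argument for Dini derivatives bounds [V], hence
   the norm, along trajectories on bounded time intervals; BIC then excludes a
   finite maximal time of existence. *)

(** * Functions of class K and piecewise linear majorants *)

Section RealFunctions.
Set Implicit Arguments.
Unset Strict Implicit.
Context {R : realType}.

Lemma within_continuous_epsP (V : normedModType R) (A : set R) (f : R -> V) :
  {within A, continuous f} <->
  (forall x, A x -> forall e : R, 0 < e -> exists2 d : R, 0 < d &
     forall y, A y -> `|x - y| < d -> `|f x - f y| < e).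
Proof.
split.
  move/subspace_continuousP => fc x Ax e e0.
  have /cvgrPdist_lt /(_ _ e0) := fc _ Ax.
  rewrite near_withinE => -[d /= d0 fd].
  by exists d => // y Ay xy; exact: fd.
move=> fc; apply/subspace_continuousP => x Ax; apply/cvgrPdist_lt => e e0.
have [d d0 fd] := fc x Ax e e0.
by rewrite near_withinE; exists d => //= y xy Ay; exact: fd.
Qed.

Lemma classK_le {gamma : R -> R} {r s : R} :
  classK gamma -> 0 <= r -> r <= s -> gamma r <= gamma s.
Proof.
move=> [_ ginc _] r0; rewrite le_eqVlt => /predU1P[->//|rs].
exact/ltW/ginc.
Qed.

Lemma classK_ge0 {gamma : R -> R} {r : R} :
  classK gamma -> 0 <= r -> 0 <= gamma r.
Proof. by move=> gK r0; have [_ _ <-] := gK; exact: classK_le. Qed.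

Lemma classK_max_le {gamma : R -> R} {r s : R} :
  classK gamma -> 0 <= r -> 0 <= s -> gamma (Num.max r s) <= gamma r + gamma s.
Proof.
move=> gK r0 s0; have := classK_ge0 gK r0; have := classK_ge0 gK s0.
by case: (leP r s) => _ ? ?; lra.
Qed.

Lemma classKinf_bounded_sublevel {gamma : R -> R} (B : R) :
  classKinf gamma -> exists2 r, 0 <= r & forall s, 0 <= s -> gamma s <= B -> s <= r.
Proof.
move=> [gK gub]; have [r r0 Br] := gub B; exists r => // s s0 sB.
rewrite leNgt; apply/negP => rs.
by have := classK_le gK r0 (ltW rs); lra.
Qed.

Lemma classKinf_id : classKinf (@id R).
Proof.
split; last first.
  move=> M; exists (Num.max 0 (M + 1)); first by rewrite le_max lexx.
  by rewrite lt_max; apply/orP; right; lra.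
by split => //; apply: continuous_subspaceT => x; exact: cvg_id.
Qed.

Section Majorant.
Variable b : nat -> R.
Hypothesis b_ge0 : forall n, 0 <= b n.

(** Partial sums of the locally finite series [r + \sum_n b n * max 0 (r - n)]; the leading [r]
    makes it strictly increasing and unbounded even where [b] vanishes. *)
Let partial (N : nat) (r : R) : R :=
  r + \sum_(0 <= n < N) b n * Num.max 0 (r - n%:R).

Let maj (r : R) : R := partial (Num.truncn r).+1 r.

(** Terms with [n >= r] vanish, so [maj] agrees with one fixed finite sum on a whole half-line; this
    transfers continuity and strict monotonicity. *)
Let majE (N : nat) (r : R) : r < N.+1%:R -> maj r = partial N.+1 r.
Proof.
move=> rN; rewrite /maj /partial; congr (_ + _).
have tN : ((Num.truncn r).+1 <= N.+1)%N.
  by rewrite ltnS real_truncn_le_nat// num_real.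
rewrite [RHS](big_cat_nat _ tN)//= [X in _ + X]big_nat_cond.
rewrite [X in _ + X]big1 ?addr0//.
move=> n; rewrite andbT => /andP[tn nN].
rewrite max_l ?mulr0// subr_le0.
have /ltW/le_trans : r < (Num.truncn r).+1%:R.
  by apply: real_truncnS_gt; exact: num_real.
by apply; rewrite ler_nat.
Qed.

Let partial_continuous (N : nat) : continuous (partial N).
Proof.
move=> r; apply: (@continuousD _ _ _ id) => //; apply: cvg_big => [|n _].
  exact: add_continuous.
apply: cvgM; first exact: cvg_cst.
apply: (@continuous_max R R (fun=> 0) (fun r => r - n%:R) r).
  exact: cvg_cst.
by apply: cvgB => //; exact: cvg_cst.
Qed.

Let maj_continuous : continuous maj.
Proof.
move=> r; have [N rN] : exists N : nat, r < N.+1%:R.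
  by exists (Num.truncn r); apply: real_truncnS_gt; exact: num_real.
rewrite /continuous_at (majE rN); apply: cvg_trans (@partial_continuous N.+1 r).
by apply: near_eq_cvg; apply: filterS (lt_nbhsl rN) => s /majE.
Qed.

Let partial_lt (N : nat) (r s : R) : r < s -> partial N r < partial N s.
Proof.
move=> rs; rewrite /partial; apply: ltr_leD => //.
apply: ler_sum => n _; apply: ler_wpM2l => //.
by rewrite ge_max !le_max lexx/= lerD2r (ltW rs) orbT.
Qed.

Let maj_lt (r s : R) : r < s -> maj r < maj s.
Proof.
move=> rs; have sN : s < (Num.truncn s).+1%:R.
  by apply: real_truncnS_gt; exact: num_real.
by rewrite (majE sN) (majE (lt_trans rs sN)) partial_lt.
Qed.

Let maj_ge (r : R) : r <= maj r.
Proof.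
by rewrite lerDl; apply: sumr_ge0 => n _; rewrite mulr_ge0// le_max lexx.
Qed.

Let maj0 : maj 0 = 0.
Proof.
by rewrite /maj /partial truncn0 add0r big_nat1 max_l ?mulr0// subr0.
Qed.

(** From [n + 1] on, the factor [max 0 (r - n)] is at least 1, so the term of index [n] alone
    suffices. *)
Let maj_seq (n : nat) (r : R) : n.+1%:R <= r -> b n <= maj r.
Proof.
move=> nr; have n0 : 0 <= n%:R :> R by [].
have r0 : 0 <= r by apply: le_trans nr.
have tn : (n < (Num.truncn r).+1)%N.
  by rewrite ltnS; apply/ltnW; rewrite truncn_gt_nat.
rewrite /maj /partial big_mkord (bigD1 (Ordinal tn))//= addrCA.
have nr1 : 1 <= Num.max 0 (r - n%:R).
  by rewrite le_max; apply/orP; right; rewrite lerBrDl natr1.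
rewrite -[leLHS]addr0 lerD//; first exact: ler_peMr.
by rewrite addr_ge0//; apply: sumr_ge0 => i _; rewrite mulr_ge0// le_max lexx.
Qed.

Lemma classKinf_majorant : exists xi : R -> R,
  [/\ continuous xi, classKinf xi &
      forall (n : nat) r, n.+1%:R <= r -> b n <= xi r].
Proof.
exists maj; split => //; split; first split => //.
- exact/continuous_subspaceT.
- by move=> r s _; exact: maj_lt.
move=> M; exists (Num.max 0 (M + 1)); first by rewrite le_max lexx.
apply: lt_le_trans (maj_ge _); rewrite lt_max; apply/orP; right; lra.
Qed.

End Majorant.
End RealFunctions.

(** * Lipschitz generalized inverses of class K_oo *)

Section LipschitzInverse.
Set Implicit Arguments.
Unset Strict Implicit.
Context {R : realType}.
Variable zeta : R -> R.
Hypothesis zeta0_ge0 : 0 <= zeta 0.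
Hypothesis zeta_le : forall r s, 0 <= r -> r <= s -> zeta r <= zeta s.

Let costs (s : R) : set R :=
  [set q + Num.max 0 (s - zeta q) | q in [set q | 0 <= q]].

Let infc (s : R) : R := inf (costs s).

Let infc_le (s q : R) : 0 <= q -> infc s <= q + Num.max 0 (s - zeta q).
Proof.
move=> q0; apply: ge_inf; last by exists q.
by exists 0 => _ [p /= p0 <-]; rewrite addr_ge0// le_max lexx.
Qed.

Let le_infc (s m : R) :
  (forall q, 0 <= q -> m <= q + Num.max 0 (s - zeta q)) -> m <= infc s.
Proof.
move=> ms; apply: lb_le_inf.
  by exists (0 + Num.max 0 (s - zeta 0)); exists 0 => /=.
by move=> _ [q /= q0 <-]; exact: ms.
Qed.

Let infc_ge0 (s : R) : 0 <= infc s.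
Proof. by apply: le_infc => q q0; rewrite addr_ge0// le_max lexx. Qed.

Let infc0 : infc 0 = 0.
Proof.
apply/eqP; rewrite eq_le infc_ge0 andbT (le_trans (infc_le 0 (lexx 0)))//.
by rewrite add0r sub0r max_l// oppr_le0.
Qed.

Let infc_lip (s t : R) : infc s <= infc t + `|s - t|.
Proof.
rewrite -lerBlDr; apply: le_infc => q q0; rewrite lerBlDr.
apply: le_trans (infc_le s q0) _; rewrite -addrA lerD2l.
have := ler_norm (s - t); have := normr_ge0 (s - t).
by case: (leP 0 (s - zeta q)); case: (leP 0 (t - zeta q)) => ? ? ? ?; lra.
Qed.

Let infc_mono (s t : R) : s <= t -> infc s <= infc t.
Proof.
move=> st; apply: le_infc => q q0; apply: le_trans (infc_le s q0) _.
by rewrite lerD2l ge_max !le_max lexx/= lerD2r st orbT.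
Qed.

Let inv (s : R) : R := infc s + (1 - (1 + s)^-1).

Let inv_step (s t : R) : 0 <= s -> s <= t ->
  0 <= (1 + s)^-1 - (1 + t)^-1 <= t - s.
Proof.
move=> s0 st; rewrite subr_ge0 lef_pV2 ?posrE; [|lra..].
apply/andP; split; first lra.
rewrite -subr_ge0.
have -> : t - s - ((1 + s)^-1 - (1 + t)^-1)
   = (t - s) * (s + t + s * t) / ((1 + s) * (1 + t)) by field; lra.
have t0 : 0 <= t := le_trans s0 st.
by rewrite divr_ge0// mulr_ge0 ?subr_ge0 ?addr_ge0 ?mulr_ge0.
Qed.

Let inv_lip (s t : R) : 0 <= s -> 0 <= t -> `|inv s - inv t| <= 2 * `|s - t|.
Proof.
wlog st : s t / s <= t.
  move=> wl s0 t0; case: (leP s t) => [|/ltW] ?; first exact: wl.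
  by rewrite distrC [`|s - t|]distrC; exact: wl.
move=> s0 t0; have /andP[h1 h2] := inv_step s0 st.
have := infc_mono st; have := infc_lip t s.
rewrite [`|s - t|]distrC [`|t - s|]ger0_norm ?subr_ge0// => h3 h4.
by rewrite distrC ger0_norm /inv; lra.
Qed.

(* [inf_q (q + max 0 (s - zeta q))] is a 1-Lipschitz generalized inverse of
   [zeta], but may be constant on intervals over which [zeta] jumps; the summand
   [s / (1 + s)] makes it strictly increasing. *)
Lemma lipschitz_classKinf_inverse : exists eta : R -> R,
  [/\ classKinf eta,
      forall s t, 0 <= s -> 0 <= t -> `|eta s - eta t| <= 2 * `|s - t| &
      forall q s, 0 <= q -> 0 <= s -> s <= zeta q -> eta s <= q + 1].
Proof.
exists inv; split => //; first split; first split.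
- apply/within_continuous_epsP => s /= s0 e e0; exists (e / 2); first by lra.
  by move=> t /= t0 st; apply: le_lt_trans (inv_lip s0 t0) _; lra.
- move=> s t s0 st; rewrite /inv ler_ltD ?infc_mono ?ltW// ltrD2l ltrN2.
  by rewrite ltf_pV2 ?posrE; lra.
- by rewrite /inv infc0 addr0 invr1; lra.
- move=> M; pose q := Num.max 0 (M + 1).
  have q0 : 0 <= q by rewrite le_max lexx.
  have z0 : 0 <= zeta q by apply: le_trans zeta0_ge0 _; exact: zeta_le.
  (* Here every cost is at least [q]: a [p >= q] contributes [q] by itself, and for [p < q]
     monotonicity of [zeta] leaves at least [q] in the second summand. *)
  exists (zeta q + q); first by lra.
  have Mq : M + 1 <= q by rewrite le_max lexx orbT.
  have : q <= infc (zeta q + q).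
    apply: le_infc => p p0; case: (leP q p) => [qp|/ltW/(zeta_le p0) zpq].
      by apply: (le_trans qp); rewrite lerDl le_max lexx.
    have : zeta q + q - zeta p <= Num.max 0 (zeta q + q - zeta p).
      by rewrite le_max lexx orbT.
    lra.
  have : (1 + (zeta q + q))^-1 <= 1 by rewrite invf_le1; lra.
  by rewrite /inv; lra.
(* If [s <= zeta q], the cost of [q] is [q] itself, and the strictly increasing correction adds at
   most 1. *)
- move=> q s q0 s0 szq; have := infc_le s q0; rewrite max_l ?subr_le0// addr0 => h.
  by have : 0 <= (1 + s)^-1; [rewrite invr_ge0; lra|rewrite /inv; lra].
Qed.

End LipschitzInverse.

(** * Comparison argument for Dini derivatives *)

Section DiniComparison.
Set Implicit Arguments.
Unset Strict Implicit.
Context {R : realType}.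

(** The bound [1 - h <= expR (- h)] gives [expR h <= 1 / (1 - h)], and [h / (1 - h) <= 2 * h] for
    [h <= 1 / 2]. *)
Lemma expRB1_le (h : R) : 0 <= h -> h <= 2^-1 -> expR h - 1 <= 2 * h.
Proof.
move=> h0 h2; have := expR_ge1Dx (- h); rewrite expRN => h1.
have e0 := expR_gt0 h.
have : (1 - h) * expR h <= 1 by rewrite -ler_pdivlMr// div1r.
by nra.
Qed.

(* [g t = (W 0 + 2 * M / a) * expR (a * t) - 2 * M / a] solves
   [g' = a * g + 2 * M]; beyond the last time at which [W <= g] the growth of
   [W] would have to exceed that of [g]. *)
Lemma dini_comparison (W : R -> R) (T a M : R) :
  0 <= T -> 0 < a -> 0 < M -> 0 <= W 0 ->
  {within `[0, T], continuous W} ->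
  (forall s, 0 <= s < T ->
    \forall h \near 0^'+, W (s + h) - W s <= h * (a * W s + 2 * M)) ->
  W T <= (W 0 + 2 * M / a) * expR (a * T).
Proof.
move=> T0 a0 M0 W00 /within_continuous_epsP Wc dW.
set b := 2 * M / a; set K := W 0 + b.
have b0 : 0 < b by rewrite /b divr_gt0// mulr_gt0.
have ab : a * b = 2 * M by rewrite /b; field; lra.
have K0 : 0 < K by rewrite /K; lra.
pose g t := K * expR (a * t) - b.
suff : W T <= g T by rewrite /g; lra.
rewrite leNgt; apply/negP => gW.
have gc : {within `[0, T], continuous g}.
  apply: continuous_subspaceT => t; apply: cvgB; last exact: cvg_cst.
  apply: cvgM; first exact: cvg_cst.
  by apply: continuous_comp; [exact: mulrl_continuous|exact: continuous_expR].
move/within_continuous_epsP in gc.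
pose E := [set t | 0 <= t <= T /\ W t <= g t].
have E0 : E 0 by split; [lra|rewrite /g mulr0 expR0 /K; lra].
have supE : has_sup E.
  by split; [exists 0|exists T => t [/andP[_ tT] _]].
pose s := sup E.
have s0 : 0 <= s by apply: ub_le_sup => //; case: supE.
have sT : s <= T by apply: ge_sup; [exists 0|move=> t [/andP[_ tT] _]].
have Ws : W s <= g s.
  (* By continuity [g < W] at [s] would persist near [s], whereas [E] has points arbitrarily close
     to its supremum. *)
  rewrite leNgt; apply/negP => gWs.
  have e0 : 0 < (W s - g s) / 2 by lra.
  have sI : `[0, T]%classic s by rewrite /= in_itv/= s0.
  have [d1 d10 Wd] := Wc s sI _ e0.
  have [d2 d20 gd] := gc s sI _ e0.
  have d0 : 0 < Num.min d1 d2 by rewrite lt_min d10.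
  have [t [t0T Wg]] := sup_adherent d0 supE.
  rewrite -/s ltrBlDl -ltrBlDr lt_min => /andP[td1 td2].
  have ts : t <= s by apply: ub_le_sup; [case: supE|split].
  have st0 : `|s - t| = s - t by rewrite ger0_norm// subr_ge0.
  have tI : `[0, T]%classic t by rewrite /= in_itv.
  have := Wd t tI; have := gd t tI; rewrite st0 => /(_ td2) + /(_ td1).
  by rewrite !ltr_norml => /andP[? ?] /andP[? ?]; lra.
have {}sT : s < T.
  rewrite lt_neqAle sT andbT; apply/eqP => sT'.
  by move: Ws; rewrite sT'; lra.
have sW : forall t, s < t -> t <= T -> g t < W t.
  move=> t st tT; rewrite ltNge; apply/negP => Wt.
  have : t <= s by apply: ub_le_sup; [case: supE|split => //; lra].
  lra.
have [h [h0 hT hW]] : exists h, [/\ 0 < h, s + h <= T &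
    W (s + h) - W s <= h * (a * W s + 2 * M)].
  have hs : 0 <= s < T by rewrite s0.
  have Ts : 0 < T - s by lra.
  have [h [[h0 hT] hW]] := filter_ex (filterI
    (filterI (nbhs_right_gt 0) (nbhs_right_lt Ts)) (dW s hs)).
  by exists h; split => //; lra.
(* As [1 + a * h <= expR (a * h)], [g (s + h)] is at least [g s + h * (a * g s + 2 * M)], which in
   turn bounds [W (s + h)] from above. *)
have := sW (s + h) ltac:(lra) hT.
have := expR_ge1Dx (a * h); have e0 := expR_gt0 (a * s).
rewrite /g mulrDr expRD => eh.
have : K * expR (a * s) * (1 + a * h) <= K * (expR (a * s) * expR (a * h)).
  by rewrite mulrA ler_wpM2l// mulr_ge0; lra.
have : h * (a * W s + 2 * M) <= h * (a * g s + 2 * M).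
  by rewrite ler_wpM2l//; [lra|rewrite lerD2r ler_wpM2l//; lra].
rewrite /g -ab; move: Ws; rewrite /g; nra.
Qed.

End DiniComparison.

(** * Bounds on the flow under robust forward completeness *)

Section ControlSystem.
Set Implicit Arguments.
Unset Strict Implicit.
Context {R : realType} {X U I : normedModType R} (S : controlSystem X U I).
Variable D : set I.

Lemma rfc_bound (r tau : R) : robustly_forward_complete S D ->
  0 < r -> 0 < tau ->
  exists2 B : R, 0 <= B & forall x u t, `|x| <= r -> D u -> 0 <= t <= tau ->
    `|flow S t x u| <= B.
Proof.
move=> [_ rfc] r0 tau0; have := rfc r tau r0 tau0.
set E := (X in ereal_sup X) => supE.
have [B EB] : exists B : R, (ereal_sup E <= B%:E)%E.
  by case: (ereal_sup E) supE => [s _|//|_]; [exists s|exists 0; rewrite leNye].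
exists (Num.max 0 B); first by rewrite le_max lexx.
move=> x u t xr Du tt; rewrite le_max; apply/orP; right; rewrite -lee_fin.
by apply: le_trans EB; apply: ereal_sup_ubound; exists t, x, u.
Qed.

Lemma bound_rfc : forward_complete S D ->
  (forall r tau : R, 0 < r -> 0 < tau -> exists B : R,
    forall x u t, `|x| <= r -> D u -> 0 <= t <= tau -> `|flow S t x u| <= B) ->
  robustly_forward_complete S D.
Proof.
move=> fc bnd; split => // r tau r0 tau0; have [B Bb] := bnd r tau r0 tau0.
apply: (@le_lt_trans _ _ B%:E); last exact: ltry.
by apply: ge_ereal_sup => _ [t [x [u [tt xr Du ->]]]]; rewrite lee_fin Bb.
Qed.

Lemma rfc_classKinf_bound : robustly_forward_complete S D ->
  exists (xi : R -> R) (c : R),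
    [/\ continuous xi, classKinf xi, 0 < c &
        flow_bounded_by S D (fun r t => xi r + xi t + c)].
Proof.
move=> rfc; have [fc _] := rfc.
have /choice [b bP] : forall n : nat, exists B : R, 0 <= B /\
    forall x u t, `|x| <= n.+1%:R -> D u -> 0 <= t <= n.+1%:R ->
    `|flow S t x u| <= B.
  move=> n; have n0 : 0 < n.+1%:R :> R by [].
  by have [B B0 Bb] := rfc_bound rfc n0 n0; exists B.
(* For [max |x| t] in [[n + 1, n + 2)] the valid bound is [b (n + 1)], hence the index shift; values
   below 1 are left to the constant [b 0 + 1]. *)
have [xi [xic xiK xib]] :=
  @classKinf_majorant _ (b \o succn) (fun n => (bP n.+1).1).
have [xiK' _] := xiK; have b0 := (bP 0%N).1.
exists xi, (b 0%N + 1); split => //; first by lra.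
move=> x u t Du t0; split; first exact: fc.
have x0 : 0 <= `|x| by [].
set q := Num.max `|x| t.
have xiq : xi q <= xi `|x| + xi t by exact: classK_max_le.
have xq : `|x| <= q by rewrite le_max lexx.
have tq : t <= q by rewrite le_max lexx orbT.
have q0 : 0 <= q := le_trans t0 tq.
have := classK_ge0 xiK' q0.
have := truncn_itv q0; case E : (Num.truncn q) => [|n] /andP[nq qn] xiq0.
  have : `|flow S t x u| <= b 0%N.
    by apply: (bP 0%N).2 => //; [lra|apply/andP; split; lra].
  lra.
have : `|flow S t x u| <= b n.+1.
  by apply: (bP n.+1).2 => //; [lra|apply/andP; split; lra].
have := xib n q nq => /=; lra.
Qed.

Lemma continuous_bound_rfc (mu : R * R -> R) : continuous_nonneg2 mu ->
  flow_bounded_by S D (fun r t => mu (r, t)) ->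
  robustly_forward_complete S D.
Proof.
move=> [muc _] bnd; apply: bound_rfc => [t x u t0 Du|r tau r0 tau0].
  by have [] := bnd x u t Du t0.
have cpt : compact (`[0, r] `*` `[0, tau] : set (R * R)).
  by apply: compact_setX; exact: segment_compact.
have /continuous_compact muc' :
    {within `[0, r] `*` `[0, tau], continuous mu}.
  apply: continuous_subspaceW muc => -[p q] /= [].
  by rewrite !in_itv/= => /andP[? _] /andP[? _].
have [B [_ /(_ (B + 1)) Bb]] := compact_bounded (muc' cpt).
exists (B + 1) => x u t xr Du /andP[t0 tt].
have [_ /le_trans] := bnd x u t Du t0; apply.
apply: le_trans (ler_norm _) _; apply: Bb; first by lra.
by exists (`|x|, t) => //=; split => /=; rewrite in_itv/= ?normr_ge0 ?t0.
Qed.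

(** * Shifting and concatenating inputs *)

Section ShiftClosed.
Hypothesis Dshift : forall u v, D u -> `|v| <= `|u| -> D v.

(** The shifted input stays in [D] because shifting does not increase the norm; as domains of
    definition are intervals, existence at time [t + h] suffices for the cocycle property. *)
Lemma shift_cocycle (u : I) (t : R) (t0 : 0 <= t) : D u ->
  exists v, [/\ D v, inputval S v = shift_input (NngNum t0) (inputval S u) &
    forall x h, 0 <= h -> flowdom S (t + h, x, u) ->
      flowdom S (h, flow S t x u, v) /\
      flow S h (flow S t x u) v = flow S (t + h) x u].
Proof.
move=> Du; have [v vu nvu] := shift_invariance S u (NngNum t0).
exists v; split => //; first exact: Dshift nvu.
move=> x h h0 /flowdomE[_ tht].
have := @flow_cocycle _ _ _ _ S x u v (NngNum t0) (NngNum h0) vu.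
apply => s /= /andP[s0 sth]; apply/flowdomE; split => //.
by apply: le_lt_trans tht; rewrite lee_fin.
Qed.

(* For every [d > 0] the two inputs have the same shift by [d], while the states
   reached at time [d] both tend to [x] as [d] tends to 0. *)
Lemma flow_eq_input0 (v w : I) : forward_complete S D -> flow_lipschitz S D ->
  D v -> D w -> (forall s, 0 < s%:num -> inputval S v s = inputval S w s) ->
  forall t x, 0 <= t -> flow S t x v = flow S t x w.
Proof.
move=> fc lip Dv Dw vw t x; rewrite le_eqVlt => /predU1P[<-|t0].
  by rewrite !flow_identity.
have r0 : 0 < `|x| + 1 by have := normr_ge0 x; lra.
have [L L0 Llip] := lip t _ t0 r0.
apply/eqP; rewrite -subr_eq0 -normr_le0; apply/ler_addgt0Pr => e e0.
(* The 1 keeps both states at time [d] in the ball on which [L] is valid; [e / (2 * L)] makes [L]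
   times their distance at most [e]. *)
rewrite add0r; pose e' := Num.min 1 (e / (2 * L)).
have e'0 : 0 < e' by rewrite lt_min ltr01 divr_gt0// mulr_gt0.
have near_x z : D z -> exists2 d : R, 0 < d &
    forall s, 0 <= s < d -> `|x - flow S s x z| < e'.
  move=> Dz; have /within_continuous_epsP zc := @flow_continuity _ _ _ _ S x z.
  have [d d0 zd] := zc 0 (fc _ _ _ (lexx 0) Dz) _ e'0.
  exists d => // s /andP[s0 sd]; rewrite -[X in X - _](flow_identity S x z).
  by apply: zd; [exact: fc|rewrite sub0r normrN ger0_norm].
have [d1 d10 d1v] := near_x v Dv; have [d2 d20 d2w] := near_x w Dw.
have [d [d0 dt dd1 dd2]] : exists d, [/\ 0 < d, d < t, d < d1 & d < d2].
  exists (Num.min t (Num.min d1 d2) / 2).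
  have m0 : 0 < Num.min t (Num.min d1 d2) by rewrite !lt_min t0 d10.
  have := lexx (Num.min t (Num.min d1 d2)).
  by rewrite !le_min => /and3P[? ? ?]; split; lra.
have [v' [Dv' v'E v'cocycle]] := shift_cocycle (ltW d0) Dv.
have [w' [Dw' w'E w'cocycle]] := shift_cocycle (ltW d0) Dw.
have vw' : v' = w'.
  apply: (inputval_inj (c := S)); rewrite v'E w'E; apply/funext => s.
  by apply: vw => /=; rewrite ltr_wpDl.
have td0 : 0 <= t - d by lra.
have tdd : d + (t - d) = t by lra.
have := v'cocycle x (t - d) td0; have := w'cocycle x (t - d) td0.
rewrite tdd.
move=> /(_ (fc _ _ _ (ltW t0) Dw))[_ <-] /(_ (fc _ _ _ (ltW t0) Dv))[_ <-].
have dv : `|x - flow S d x v| < e' by apply: d1v; rewrite (ltW d0).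
have dw : `|x - flow S d x w| < e' by apply: d2w; rewrite (ltW d0).
have e'1 : e' <= 1 by rewrite ge_min lexx.
have ball_r y : `|x - y| < e' -> `|y| < `|x| + 1.
  move=> xy; have := ler_normB x (x - y); rewrite opprB addrC subrK; lra.
rewrite -vw'.
apply: le_trans (Llip _ _ _ _ (ball_r _ dv) (ball_r _ dw) _ Dv' _ _) _.
- by apply/andP; split; lra.
- exact: fc.
- exact: fc.
rewrite -ler_pdivlMl//.
have : e' <= e / (2 * L) by rewrite ge_min lexx orbT.
have -> : e / (2 * L) = L^-1 * e / 2 by field; lra.
have := ler_distD x (flow S d x v) (flow S d x w); rewrite [`|flow S d x v - x|]distrC.
lra.
Qed.

(* The shift by [h] of the concatenation at [h] takes at [0] the value of the
   first input instead of that of the second; by the preceding lemma the flow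
   does not see this. *)
Lemma flow_concat (u v : I) (h : R) : forward_complete S D ->
  flow_lipschitz S D -> concatenation_axiom S D -> D u -> D v -> 0 < h ->
  exists2 w, D w & forall x t, 0 <= t ->
    flow S t (flow S h x u) v = flow S (h + t) x w.
Proof.
move=> fc lip concat Du Dv h0.
have [w Dw wE] := concat u v (NngNum (ltW h0)) Du Dv h0.
have [w' [Dw' w'E w'cocycle]] := shift_cocycle (ltW h0) Dw.
exists w => // x t t0.
have ht0 : 0 <= h + t by lra.
have [_ <-] := w'cocycle x t t0 (fc _ _ _ ht0 Dw).
have -> : flow S h x w = flow S h x u.
  have [|_ ->//] := @flow_causality _ _ _ _ S h x w u (fc _ _ _ (ltW h0) Dw).
  by move=> s sh; rewrite wE /concat_input/= sh.
apply: flow_eq_input0 => // s s0.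
rewrite w'E wE /shift_input /concat_input/= leNgt ltrDr s0/=.
by congr (inputval S v _); apply/val_inj => /=; rewrite addrK ger0_norm.
Qed.

End ShiftClosed.
End ControlSystem.

(** * Lyapunov functions imply robust forward completeness *)

Section Lyapunov.
Set Implicit Arguments.
Unset Strict Implicit.
Context {R : realType} {X U I : normedModType R} (S : controlSystem X U I).
Variable D : set I.
Hypothesis Dshift : forall u v, D u -> `|v| <= `|u| -> D v.

Lemma lipschitz_on_ballsP (V : X -> R) (r : R) : lipschitz_on_balls V -> 0 < r ->
  exists2 k : R, 0 < k &
    forall x y, `|x| < r -> `|y| < r -> `|V x - V y| <= k * `|x - y|.
Proof.
move=> Vlip r0; have [B [_ Bk]] := Vlip r r0.
exists (Num.max 1 (B + 1)); first by rewrite lt_max ltr01.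
move=> x y xr yr; apply: (Bk _ _ (x, y)) => //.
by rewrite lt_max; apply/orP; right; lra.
Qed.

(** The limsup is an infimum of suprema over right neighbourhoods of 0; being strictly below [m], it
    has one such supremum below [m]. *)
Lemma dini_le (V : X -> R) (x : X) (u : I) (l m : R) :
  (dini S V x u <= l%:E)%E -> l < m ->
  \forall h \near (0 : R)^'+, V (flow S h x u) - V x <= h * m.
Proof.
move=> Vl lm; have : (dini S V x u < m%:E)%E.
  by apply: le_lt_trans Vl _; rewrite lte_fin.
move=> /ereal_inf_lt[_ [A A0 <-]] Am; near=> h.
have h0 : 0 < h by near: h; exact: nbhs_right_gt.
rewrite -ler_pdivrMl// -lee_fin; apply: le_trans (ltW Am).
by apply: ereal_sup_ubound; exists h => //; near: h.
Unshelve. all: by end_near. Qed.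

Lemma dini_ge (V : X -> R) (x : X) (u : I) (m : R) :
  (\forall h \near (0 : R)^'+, h^-1 * (V (flow S h x u) - V x) <= m) ->
  (dini S V x u <= m%:E)%E.
Proof.
move=> Vm; apply: ge_ereal_inf; eexists.
  by eexists; [exact: Vm|reflexivity].
by apply: ge_ereal_sup => _ [h /= hm <-]; rewrite lee_fin.
Qed.

(** By the cocycle property, increments of [V] after time [s] start at the state reached at [s]
    under the shifted input, where the Dini bound applies again. *)
Lemma lyapunov_growth (V : X -> R) (a M : R) :
  lipschitz_on_balls V -> (forall x, 0 <= V x) -> 0 < a -> 0 < M ->
  (forall x u, D u -> (dini S V x u <= (a * V x + M)%:E)%E) ->
  forall x u t, D u -> flowdom S (t, x, u) ->
    V (flow S t x u) <= (V x + 2 * M / a) * expR (a * t).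
Proof.
move=> Vlip V0 a0 M0 dV x u T Du /[dup] dT /flowdomE[T0 Tmax].
have dom s : 0 <= s <= T -> flowdom S (s, x, u).
  move=> /andP[s0 sT]; apply/flowdomE; split => //.
  by apply: le_lt_trans Tmax; rewrite lee_fin.
rewrite -[X in V X + _](flow_identity S x u).
apply: (@dini_comparison _ (fun t => V (flow S t x u))) => //.
  apply/within_continuous_epsP => s /=; rewrite in_itv/= => sT e e0.
  have r0 : 0 < `|flow S s x u| + 1 by have := normr_ge0 (flow S s x u); lra.
  have [k k0 Vk] := lipschitz_on_ballsP Vlip r0.
  have /within_continuous_epsP fc := @flow_continuity _ _ _ _ S x u.
  have e'0 : 0 < Num.min 1 (e / k) by rewrite lt_min ltr01 divr_gt0.
  have [d d0 fd] := fc s (dom s sT) _ e'0; exists d => // t.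
  rewrite /= in_itv/= => tT std; have := fd t (dom t tT) std.
  rewrite lt_min => /andP[ft1 fte]; apply: le_lt_trans (Vk _ _ _ _) _; first lra.
    have := ler_normB (flow S s x u) (flow S s x u - flow S t x u).
    by rewrite opprB addrC subrK; lra.
  by rewrite mulrC -ltr_pdivlMr.
move=> s /andP[s0 sT]; have [v [Dv vE vcocycle]] := shift_cocycle S Dshift s0 Du.
(* Replacing [M] by [2 * M] provides the strict inequality that turns the limsup bound into one for
   all small [h]. *)
have := dini_le (dV (flow S s x u) v Dv) (m := a * V (flow S s x u) + 2 * M).
move=> /(_ ltac:(lra)) Vh; near=> h.
have h0 : 0 < h by near: h; exact: nbhs_right_gt.
have hT : h < T - s by near: h; apply: nbhs_right_lt; lra.
have [|_ <-] := vcocycle x h (ltW h0); first by apply: dom; apply/andP; split; lra.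
by near: h.
Unshelve. all: by end_near. Qed.

Lemma lyapunov_rfc (V : X -> R) (psi1 psi2 : R -> R) (C a M : R) :
  BIC S -> lipschitz_on_balls V -> (forall x, 0 <= V x) ->
  classKinf psi1 -> classKinf psi2 ->
  (forall x, psi1 `|x| <= V x <= psi2 `|x| + C) ->
  0 < a -> 0 < M ->
  (forall x u, D u -> (dini S V x u <= (a * V x + M)%:E)%E) ->
  robustly_forward_complete S D.
Proof.
move=> bic Vlip V0 psi1K [psi2K _] Vpsi a0 M0 dV.
have Ma0 : 0 < 2 * M / a by rewrite divr_gt0// mulr_gt0.
(* Used twice: with [B = V x] to contradict BIC at a finite [tmax], and with [B = psi2 r + C] for
   the uniform bound over a ball. *)
have growth (B tau : R) : exists2 r, 0 <= r & forall x u t, D u ->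
    V x <= B -> flowdom S (t, x, u) -> t <= tau -> `|flow S t x u| <= r.
  have [r r0 psir] :=
    classKinf_bounded_sublevel ((B + 2 * M / a) * expR (a * tau)) psi1K.
  exists r => // x u t Du VB dt ttau; apply: psir => //.
  have /andP[+ _] := Vpsi (flow S t x u); move/le_trans; apply.
  apply: le_trans (lyapunov_growth Vlip V0 a0 M0 dV Du dt) _.
  apply: ler_pM; rewrite ?expR_ge0 ?ler_expR ?ler_pM2l//; last by rewrite lerD2r.
  by rewrite addr_ge0// ltW.
have fc : forward_complete S D.
  move=> t x u t0 Du; apply/flowdomE; split => //.
  have [tmax_fin|] := ltP (tmax S x u) +oo%E; last first.
    by rewrite leye_eq => /eqP ->; exact: ltry.
  have [tau tauE] : exists tau : R, tmax S x u = tau%:E.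
    have := tmax_gt0 S x u; move: tmax_fin; case: (tmax S x u) => [tau|//|//] _ _.
    by exists tau.
  have [r r0 bnd] := growth (V x) tau.
  have r10 : 0 < r + 1 by lra.
  have [s [s0 sT rs]] := bic x u tmax_fin _ r10.
  have sr : `|flow S s x u| <= r.
    by apply: bnd => //; [apply/flowdomE|move: sT; rewrite tauE lte_fin => /ltW].
  by have := lt_le_trans rs sr; rewrite gtrDl ltr10.
apply: bound_rfc => // r tau r0 tau0.
have [B B0 bnd] := growth (psi2 r + C) tau.
exists B => x u t xr Du /andP[t0 ttau]; apply: bnd => //; last exact: fc.
have /andP[_] := Vpsi x; move/le_trans; apply.
by rewrite lerD2r; exact: (classK_le psi2K).
Qed.

(** * Construction of the Lyapunov function *)

Section Converse.
Variables (xi : R -> R) (c : R).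
Hypotheses (xiK : classK xi) (c0 : 0 < c).
Hypothesis flow_xi : flow_bounded_by S D (fun r t => xi r + xi t + c).
Hypothesis lip : flow_lipschitz S D.
Hypothesis concat : concatenation_axiom S D.
Hypothesis D0 : D 0.
Variable eta : R -> R.
Hypothesis etaK : classKinf eta.
Hypothesis eta_lip :
  forall s t, 0 <= s -> 0 <= t -> `|eta s - eta t| <= 2 * `|s - t|.
Hypothesis eta_xi :
  forall q s, 0 <= q -> 0 <= s -> s <= 2 * xi q + c -> eta s <= q + 1.

Let w (t : R) (x : X) (u : I) : R :=
  Num.max 1 (expR (- t) * eta `|flow S t x u|).

Let Vset (x : X) : set R :=
  [set y | exists t u, [/\ 0 <= t, D u & y = w t x u]].

Let V (x : X) : R := sup (Vset x).

Let fc : forward_complete S D.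
Proof. by move=> t x u t0 Du; have [] := flow_xi x Du t0. Qed.

(** With [q] the maximum of [|x|] and [t], the flow is bounded by [2 * xi q + c], which [eta] sends
    below [q + 1]. *)
Let eta_flow (t : R) (x : X) (u : I) : 0 <= t -> D u ->
  0 <= eta `|flow S t x u| <= `|x| + t + 1.
Proof.
move=> t0 Du; rewrite (classK_ge0 etaK.1)//=.
have x0 : 0 <= `|x| by [].
have q0 : 0 <= Num.max `|x| t by rewrite le_max x0.
have xq : `|x| <= Num.max `|x| t by rewrite le_max lexx.
have tq : t <= Num.max `|x| t by rewrite le_max lexx orbT.
apply: (@le_trans _ _ (Num.max `|x| t + 1)).
  apply: eta_xi => //; have [_ /le_trans] := flow_xi x Du t0; apply.
  by have := classK_le xiK x0 xq; have := classK_le xiK t0 tq; lra.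
by rewrite lerD2r ge_max lerDl lerDr t0 x0.
Qed.

(** The weight [expR (- t)] absorbs the growth in [t], as [|x| + t + 1 <= (|x| + 2) * (1 + t)]. This
    makes the supremum [V] finite and yields [psi2 = id] and [C = 2]. *)
Let w_ub (t : R) (x : X) (u : I) : 0 <= t -> D u -> w t x u <= `|x| + 2.
Proof.
move=> t0 Du; have x0 : 0 <= `|x| by [].
rewrite /w ge_max; apply/andP; split; first lra.
have /andP[e1 e2] := eta_flow x t0 Du.
rewrite expRN ler_pdivrMl ?expR_gt0//; have := expR_ge1Dx t; nra.
Qed.

Let w_le_V (t : R) (x : X) (u : I) : 0 <= t -> D u -> w t x u <= V x.
Proof.
move=> t0 Du; apply: ub_le_sup; last by exists t, u.
by exists (`|x| + 2) => _ [s [v [s0 Dv ->]]]; exact: w_ub.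
Qed.

Let V_le (x : X) (m : R) :
  (forall t u, 0 <= t -> D u -> w t x u <= m) -> V x <= m.
Proof.
move=> wm; apply: ge_sup; first by exists (w 0 x 0), 0, 0.
by move=> _ [t [u [t0 Du ->]]]; exact: wm.
Qed.

Let V_ge1 (x : X) : 1 <= V x.
Proof. by apply: le_trans (w_le_V x (lexx 0) D0); rewrite le_max lexx. Qed.

Let V_lipschitz_on_balls : lipschitz_on_balls V.
Proof.
(* Past the horizon [2 * (r + 2)] one has [expR t >= (1 + t / 2) ^ 2 >= r + t + 1], so that [w]
   equals 1 on the ball. *)
move=> r r0; have T0 : 0 < 2 * (r + 2) by lra.
have [L L0 Llip] := lip T0 r0.
(* It suffices to compare [w] at [x] and [y] for the same [t] and [u]; [2 * L] combines the
   Lipschitz constants of [eta] and of the flow. *)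
have V_sub x y : `|x| < r -> `|y| < r -> V x <= V y + 2 * L * `|x - y|.
  move=> xr yr; apply: V_le => t u t0 Du; have := w_le_V y t0 Du.
  have /andP[ex0 ex] := eta_flow x t0 Du; have /andP[ey0 ey] := eta_flow y t0 Du.
  have xy0 : 0 <= 2 * L * `|x - y| by rewrite mulr_ge0// mulr_ge0// ltW.
  have et0 := expR_gt0 t; rewrite /w ge_max => /andP[Vy1 Vy2].
  rewrite ge_max; apply/andP; split; first lra.
  have [tT|/ltW Tt] := leP t (2 * (r + 2)).
    have := Llip x y t u xr yr; rewrite t0 tT => /(_ erefl Du (fc _ t0 Du) (fc _ t0 Du)).
    have := eta_lip (normr_ge0 (flow S t x u)) (normr_ge0 (flow S t y u)).
    have := ler_dist_dist (flow S t x u) (flow S t y u).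
    have := ler_norm (eta `|flow S t x u| - eta `|flow S t y u|) => h1 h2 h3 h4.
    have h5 : eta `|flow S t x u| <= eta `|flow S t y u| + 2 * L * `|x - y| by lra.
    have et1 : expR (- t) <= 1 by rewrite expR_le1 oppr_le0.
    have et2 := expR_ge0 (- t); nra.
  apply: (@le_trans _ _ 1); last by have := V_ge1 y; lra.
  rewrite expRN ler_pdivrMl ?expR_gt0// mulr1.
  have := expR_ge1Dx (t / 2); have -> : expR t = expR (t / 2) * expR (t / 2).
    by rewrite -expRD; congr expR; field.
  nra.
have ball0 : ([set x : X | `|x| < r] `*` [set x | `|x| < r]) (0 : X, 0 : X).
  by split; rewrite /= normr0.
have ballPF := globally_properfilter ball0.
apply: (@klipschitzW _ _ _ (2 * L)) => -[x y] /= [xr yr].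
have := V_sub x y xr yr; have := V_sub y x yr xr; rewrite distrC => ? ?.
by rewrite ler_norml; apply/andP; split; lra.
Qed.

(** Following [u] up to time [h] and then [v] is a single input in [D] starting at [x]; its weight
    at time [h + t] differs from that at [t] by the factor [expR (- h)]. *)
Let V_flow (x : X) (u : I) (h : R) : 0 < h -> D u ->
  V (flow S h x u) <= expR h * V x.
Proof.
move=> h0 Du; have h1 : 1 <= expR h by have := expR_ge1Dx h; lra.
apply: V_le => t v t0 Dv; have [z Dz zE] := flow_concat Dshift fc lip concat Du Dv h0.
have ht0 : 0 <= h + t by lra.
rewrite /w ge_max zE//; apply/andP; split; first by have := V_ge1 x; nra.
have := w_le_V x ht0 Dz; rewrite /w ge_max => /andP[_].
by rewrite opprD expRD -mulrA !expRN !ler_pdivrMl ?expR_gt0.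
Qed.

Lemma converse_lyapunov : exists (V : X -> R) (psi1 psi2 : R -> R) (C : R),
  [/\ lipschitz_on_balls V /\ (forall x, 0 <= V x),
      classKinf psi1, classKinf psi2, 0 < C &
      (forall x, psi1 `|x| <= V x <= psi2 `|x| + C) /\
      exists a M : R, [/\ 0 < a, 0 < M &
        forall x u, D u -> (dini S V x u <= (a * V x + M)%:E)%E] ].
Proof.
exists V, eta, id, 2; split => //.
- by split => // x; apply: le_trans (V_ge1 x).
- exact: classKinf_id.
split.
  move=> x; apply/andP; split; last by apply: V_le => t u; exact: w_ub.
  apply: le_trans (w_le_V x (lexx 0) D0).
  by rewrite /w oppr0 expR0 mul1r flow_identity le_max lexx orbT.
(* For [h <= 1 / 2] the increment of [V] is at most [(expR h - 1) * V x <= 2 * h * V x], whence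
   [a = 2]. *)
exists 2, 1; split => // x u Du; apply: dini_ge; near=> h.
have h0 : 0 < h by near: h; exact: nbhs_right_gt.
have h2 : h <= 2^-1 by near: h; apply: nbhs_right_le; lra.
rewrite ler_pdivrMl//.
have := V_flow x h0 Du; have := expRB1_le (ltW h0) h2; have := V_ge1 x; nra.
Unshelve. all: by end_near. Qed.

End Converse.
End Lyapunov.

(** * The cycle of implications *)

Theorem theorem3p7 (R : realType) (X U I : normedModType R)
    (S : controlSystem X U I) (rho : \bar R) (rho_ge0 : (0 <= rho)%E)
    (D : set I) (DE : D = input_ball rho)
    (Dconcat : concatenation_axiom S D)
    (Sbic : BIC S)
    (Slip : flow_lipschitz S D) :
  [<-> robustly_forward_complete S D ;
       exists mu : R * R -> R,
         [/\ continuous_nonneg2 mu, increasing2 mu &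
             flow_bounded_by S D (fun r t => mu (r, t))] ;
       exists mu : R * R -> R,
         continuous_nonneg2 mu /\
         flow_bounded_by S D (fun r t => mu (r, t)) ;
       exists (xi : R -> R) (c : R),
         [/\ classKinf xi, 0 < c &
             flow_bounded_by S D (fun r t => xi r + xi t + c)] ;
       exists (V : X -> R) (psi1 psi2 : R -> R) (C : R),
         [/\ lipschitz_on_balls V /\ (forall x, 0 <= V x),
             classKinf psi1, classKinf psi2, 0 < C &
             (forall x, psi1 `|x| <= V x <= psi2 `|x| + C) /\
             exists a M : R, [/\ 0 < a, 0 < M &
               forall x u, D u -> (dini S V x u <= (a * V x + M)%:E)%E] ] ].
Proof.
have Dshift u v : D u -> `|v| <= `|u| -> D v.
  by rewrite DE /input_ball/= => Du vu; apply: le_trans Du; rewrite lee_fin.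
have D0 : D 0 by rewrite DE /input_ball/= normr0.
(* The implications are proved in the order (iv) => (v), (v) => (i), (iii) => (iv), (ii) => (iii),
   (i) => (ii). *)
split; first last.
  split; first last.
    split; first last.
      split.
        move=> [xi [c [[xiK xiub] c0 flow_xi]]].
        have z0 : 0 <= 2 * xi 0 + c by have [_ _ ->] := xiK; lra.
        have zle r s : 0 <= r -> r <= s -> 2 * xi r + c <= 2 * xi s + c.
          by move=> r0 rs; have := classK_le xiK r0 rs; lra.
        have [eta [etaK eta_lip eta_xi]] :=
          @lipschitz_classKinf_inverse _ (fun q => 2 * xi q + c) z0 zle.
        exact: converse_lyapunov eta_xi.
      move=> [V [psi1 [psi2 [C [[Vlip V0] psi1K psi2K C0]]]]].
      move=> [Vpsi [a [M [a0 M0 dV]]]].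
      exact: (lyapunov_rfc Dshift Sbic Vlip V0 psi1K psi2K Vpsi a0 M0 dV).
    (* This implication passes through (i). *)
    move=> [mu [muc flow_mu]].
    have [xi [c [_ xiK c0 flow_xi]]] :=
      rfc_classKinf_bound (continuous_bound_rfc muc flow_mu).
    by exists xi, c.
  by move=> [mu [muc _ flow_mu]]; exists mu.
move=> /rfc_classKinf_bound[xi [c [xic [xiK _] c0 flow_xi]]].
exists (fun p => xi p.1 + xi p.2 + c); split => //.
- split; last first.
    move=> [r t] [/= r0 t0].
    by have := classK_ge0 xiK r0; have := classK_ge0 xiK t0; lra.
  apply: continuous_subspaceT => p; apply: cvgD; last exact: cvg_cst.
  by apply: cvgD; apply: (continuous_comp _ (xic _)); [exact: cvg_fst|exact: cvg_snd].
- move=> r1 r2 R1 R2 r10 r20 rR1 rR2 /=.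
  by have := classK_le xiK r10 rR1; have := classK_le xiK r20 rR2; lra.
Qed.
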